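(* Let $\Sigma$ be an alphabet, let $(I_1,O_1)$ and $(I_2,O_2)$ be IO signatures of $\Sigma$ with $I_1\cup I_2=\Sigma$, let $A_1$ be an $I_1$-interface automaton and $A_2$ an $I_2$-interface automaton, and suppose that the composite interface automaton $A_1\parallel A_2$ is defined. Then $$\mathcal{C}_{A_1\parallel A_2}=\mathcal{C}_{A_1}\parallel\mathcal{C}_{A_2},$$ i.e. the interface hypercontract associated with the composition of the automata is the parallel composition of the interface hypercontracts associated with them.
   Context: An IO signature $(I,O)$ of an alphabet $\Sigma$ is a partition of $\Sigma$ into two disjoint (possibly empty) sets. A language $L\subseteq\Sigma^*$ is $I$-receptive if it is nonempty, prefix-closed, and for all $w\in L$, $w'\in I^*$ one has $w\circ w'\in L$ ($\circ$ is concatenation, of words and of languages). $\mathcal{L}_I$ is the set of $I$-receptive languages ordered by inclusion; $\mathcal{L}_\emptyset$ is the set of nonempty prefix-closed languages. For signatures with $I\cup I'=\Sigma$ (compatible), the composition of $L\in\mathcal{L}_I$ and $L'\in\mathcal{L}_{I'}$ is $L\times L'=L\cap L'$, regarded as an element of $\mathcal{L}_{I\cap I'}$. Interface automata. An $I$-interface automaton is a tuple $A=(Q,q_0,\to)$ with $Q$ a finite set of states, $q_0\in Q$ the initial state, and $\to\ \subseteq Q\times\Sigma\times Q$ a deterministic transition relation (for each state and symbol there is at most one next state). Its language $\ell(A)\in\mathcal{L}_\emptyset$ is the set of all words (including the empty word) labelling a finite path of transitions starting at $q_0$. Composition of automata. Let $A_i=(Q_i,q_{i,0},\to_i)$ be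 an $I_i$-interface automaton, $i\in\{1,2\}$, with $I_1\cup I_2=\Sigma$. On $Q_1\times Q_2$ let $(q_1,q_2)\xrightarrow{\sigma}_c(q_1',q_2')$ iff $q_1\xrightarrow{\sigma}_1 q_1'$ and $q_2\xrightarrow{\sigma}_2 q_2'$, for $\sigma\in\Sigma$. Let $N\subseteq Q_1\times Q_2$ (invalid states) be the smallest set such that: (a) $(q_1,q_2)\in N$ whenever there is $\sigma\in O_2$ such that $q_2$ has a $\sigma$-transition in $A_2$ but $q_1$ has no $\sigma$-transition in $A_1$, or there is $\sigma\in O_1$ such that $q_1$ has a $\sigma$-transition in $A_1$ but $q_2$ has no $\sigma$-transition in $A_2$; and (b) $(q_1,q_2)\in N$ whenever $(q_1,q_2)\xrightarrow{\sigma}_c(q_1',q_2')$ for some $\sigma\in O_1\cup O_2$ and some $(q_1',q_2')\in N$. Then $A_1\parallel A_2$ is the $(I_1\cap I_2)$-interface automaton (with signature $(I_1\cap I_2,O_1\cup O_2)$) with states $(Q_1\times Q_2)\setminus N$, initial state $(q_{1,0},q_{2,0})$, and the transitions of $\to_c$ whose source and target are both outside $N$. It is defined when $(q_{1,0},q_{2,0})\notin N$. Interface hypercontracts. For $\Gamma\subseteq\Sigma$ let $\mathrm{MissExt}(S,S,\Gamma)=\big((S\circ\Gamma)\setminus S\big)\circ\Sigma^*$. For $S\in\mathcal{L}_\emptyset$ and a signature $(I,O)$ put $E_S=S\cup\mathrm{MissExt}(S,S,O)\in\mathcal{L}_O$ and $M_S=S\cup\mathrm{MissExt}(S,S,I)\in\mathcal{L}_I$.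 The interface hypercontract $\mathcal{C}_S$ determined by $S$ and $(I,O)$ has environments $\mathcal{E}_S=\{E\in\mathcal{L}_O : E\subseteq E_S\}$, closed-system specification $\{N\in\mathcal{L}_\emptyset : N\subseteq S\}$, and implementations $\mathcal{I}_S=\{M\in\mathcal{L}_I : M\subseteq M_S\}$. For an $I$-interface automaton $A$, $\mathcal{C}_A$ is the interface hypercontract determined by $\ell(A)$ and $(I,O)$. Refinement $\mathcal{C}\le\mathcal{C}'$ means that every environment of $\mathcal{C}'$ is an environment of $\mathcal{C}$ and every implementation of $\mathcal{C}$ is an implementation of $\mathcal{C}'$. Parallel composition of interface hypercontracts. For sets $H,H'$ of receptive languages, write $H\parallel H'=\{N\times N' : N\in H, N'\in H'\}$. If $\mathcal{C}_S$, $\mathcal{C}_{S'}$ have signatures $(I,O)$, $(I',O')$ with $I\cup I'=\Sigma$, then $\mathcal{C}_S\parallel\mathcal{C}_{S'}$ is the smallest (with respect to refinement) interface hypercontract $\mathcal{C}_R$ with signature $(I\cap I',O\cup O')$, $R\in\mathcal{L}_\emptyset$, such that $\mathcal{I}_S\parallel\mathcal{I}_{S'}\subseteq\mathcal{I}_R$, $\mathcal{E}_R\parallel\mathcal{I}_S\subseteq\mathcal{E}_{S'}$ and $\mathcal{E}_R\parallel\mathcal{I}_{S'}\subseteq\mathcal{E}_S$, where $\mathcal{E}_R,\mathcal{I}_R$ are its environments and implementations. *)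

(* Defs.v *)
From HB Require Import structures.
From mathcomp Require Import all_boot.
From mathcomp Require Import boolp classical_sets.

Set Implicit Arguments.
Unset Strict Implicit.
Unset Printing Implicit Defensive.

Local Open Scope classical_set_scope.

Record io_sig (Sigma : Type) := IOSig {
  inp : set Sigma;
  out : set Sigma;
  inpUout : inp `|` out = setT;
  inpIout : inp `&` out = set0 }.

Definition compatible (Sigma : Type) (s1 s2 : io_sig Sigma) : Prop :=
  inp s1 `|` inp s2 = setT.

Lemma par_sigU (Sigma : Type) (s1 s2 : io_sig Sigma) :
  (inp s1 `&` inp s2) `|` (out s1 `|` out s2) = setT.
Proof.
apply/seteqP; split=> // a _.
have [i1|o1] : (inp s1 `|` out s1) a by rewrite inpUout.
  have [i2|o2] : (inp s2 `|` out s2) a by rewrite inpUout.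
    by left.
  by right; right.
by right; left.
Qed.

Lemma par_sigI (Sigma : Type) (s1 s2 : io_sig Sigma) :
  (inp s1 `&` inp s2) `&` (out s1 `|` out s2) = set0.
Proof.
apply/seteqP; split=> // a [[i1 i2]] [o1|o2].
  by rewrite -(inpIout s1).
by rewrite -(inpIout s2).
Qed.

Definition par_sig (Sigma : Type) (s1 s2 : io_sig Sigma) : io_sig Sigma :=
  IOSig (par_sigU s1 s2) (par_sigI s1 s2).

Section Languages.
Variable Sigma : Type.

Definition language := set (seq Sigma).

Definition lang_cat (L L' : language) : language :=
  [set u ++ v | u in L & v in L'].

Definition letters (G : set Sigma) : language := [set [:: a] | a in G].

Definition words_over (G : set Sigma) : language := [set w | all (mem G) w].

Definition prefix_closed (L : language) : Prop :=
  forall u v, L (u ++ v) -> L u.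

Definition receptive (I : set Sigma) : set language :=
  [set L | [/\ L !=set0, prefix_closed L &
               forall w w', L w -> words_over I w' -> L (w ++ w')]].

Definition miss_ext (S : language) (G : set Sigma) : language :=
  lang_cat (lang_cat S (letters G) `\` S) setT.

Definition lang_comp (L L' : language) : language := L `&` L'.

Definition langs_comp (H H' : set language) : set language :=
  [set lang_comp N N' | N in H & N' in H'].

End Languages.

(* The signature is a phantom parameter: it records that the automaton is an
   (inp s)-interface automaton. *)
Record automaton (Sigma : Type) (s : io_sig Sigma) := Automaton {
  state : finType;
  init : state;
  step : state -> Sigma -> state -> Prop;
  step_det : forall q a q1 q2, step q a q1 -> step q a q2 -> q1 = q2 }.

Section AutomatonLanguage.
Variables (Sigma : Type) (s : io_sig Sigma) (A : automaton s).

Definition enabled (q : state A) (a : Sigma) : Prop := exists q', step q a q'.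

Fixpoint run (q : state A) (w : seq Sigma) (q' : state A) : Prop :=
  if w is a :: w' then exists2 r, step q a r & run r w' q' else q = q'.

Definition lang : language Sigma := [set w | exists q, run (init A) w q].

End AutomatonLanguage.

Section AutomatonComposition.
Variables (Sigma : Type) (s1 s2 : io_sig Sigma).
Variables (A1 : automaton s1) (A2 : automaton s2).

Definition prod_step (q : state A1 * state A2) (a : Sigma)
    (q' : state A1 * state A2) : Prop :=
  step q.1 a q'.1 /\ step q.2 a q'.2.

Inductive invalid : state A1 * state A2 -> Prop :=
| invalid_out2 q a : out s2 a -> enabled q.2 a -> ~ enabled q.1 a -> invalid q
| invalid_out1 q a : out s1 a -> enabled q.1 a -> ~ enabled q.2 a -> invalid q
| invalid_step q a q' :
    (out s1 `|` out s2) a -> prod_step q a q' -> invalid q' -> invalid q.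

Definition par_defined : Prop := ~ invalid (init A1, init A2).

Definition par_state : finType :=
  {q : state A1 * state A2 | `[< ~ invalid q >]}.

Definition par_init (h : par_defined) : par_state :=
  exist _ (init A1, init A2) (asboolT h).

Definition par_step (q : par_state) (a : Sigma) (q' : par_state) : Prop :=
  prod_step (val q) a (val q').

Lemma par_step_det q a q1 q2 :
  par_step q a q1 -> par_step q a q2 -> q1 = q2.
Proof.
move=> [x1 x2] [y1 y2]; apply: val_inj.
rewrite [val q1]surjective_pairing [val q2]surjective_pairing.
by rewrite (step_det x1 y1) (step_det x2 y2).
Qed.

Definition par_automaton (h : par_defined) : automaton (par_sig s1 s2) :=
  Automaton (par_sig s1 s2) (par_init h) par_step_det.

End AutomatonComposition.

Record hypercontract (Sigma : Type) := Hypercontract {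
  environments : set (language Sigma);
  closed_spec : set (language Sigma);
  implementations : set (language Sigma) }.

Section InterfaceHypercontracts.
Variable Sigma : Type.
Implicit Types (s : io_sig Sigma) (S : language Sigma).
Implicit Types C : hypercontract Sigma.

Definition max_env s S : language Sigma := S `|` miss_ext S (out s).

Definition max_impl s S : language Sigma := S `|` miss_ext S (inp s).

Definition interface_hc s S : hypercontract Sigma := Hypercontract
  [set E | receptive (out s) E /\ E `<=` max_env s S]
  [set N | receptive set0 N /\ N `<=` S]
  [set M | receptive (inp s) M /\ M `<=` max_impl s S].

Definition is_interface_hc s C : Prop :=
  exists2 R, receptive set0 R & C = interface_hc s R.

Definition refines C C' : Prop :=
  environments C' `<=` environments C /\
  implementations C `<=` implementations C'.

Definition par_admissible s1 s2 C1 C2 C : Prop :=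
  [/\ is_interface_hc (par_sig s1 s2) C,
      langs_comp (implementations C1) (implementations C2)
        `<=` implementations C,
      langs_comp (environments C) (implementations C1) `<=` environments C2 &
      langs_comp (environments C) (implementations C2) `<=` environments C1].

(* The parallel composition, being defined as a smallest element, is a partial
   operation: [is_hc_par s1 s2 C1 C2 C] says that the parallel composition of
   C1 (of signature s1) and C2 (of signature s2) exists and is C. *)
Definition is_hc_par s1 s2 C1 C2 C : Prop :=
  par_admissible s1 s2 C1 C2 C /\
  forall C', par_admissible s1 s2 C1 C2 C' -> refines C C'.

End InterfaceHypercontracts.

Definition automaton_hc (Sigma : Type) (s : io_sig Sigma) (A : automaton s) :
  hypercontract Sigma := interface_hc s (lang A).

(* Main.v *)
Require Import Defs.
From mathcomp Require Import all_boot.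
From mathcomp Require Import boolp classical_sets.

(** Write L1, L2 and R for the languages of A1, A2 and of their composite.  A
    word lies in S together with its missing G-extensions iff the letter at
    which it first leaves S, if any, is in G.  Two facts about R suffice.
    - R is closed under the outputs of either component ([output_closed]): a
      valid pair of states agrees on outputs, and an output step into an invalid
      state would make its source invalid.  This gives admissibility of R.
    - A word of L1 and L2 that leaves R at its last letter can be continued by
      outputs alone to a [clash], a word of both languages after which one
      component emits an output that the other refuses.  Since environments are
      receptive to these outputs, no environment of an admissible contract
      contains such a word.  This gives minimality. *)

Set Implicit Arguments.
Unset Strict Implicit.
Unset Printing Implicit Defensive.

Local Open Scope classical_set_scope.

(** * Prefix-closed languages and their missing extensions *)

Section PrefixClosedLanguages.
Variable Sigma : Type.
Implicit Types (S L E M : language Sigma) (G I O : set Sigma).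
Implicit Types (u v w : seq Sigma).

(** Common form of [max_env] ([G] the outputs) and [max_impl] ([G] the inputs). *)
Definition extension S G : language Sigma := S `|` miss_ext S G.

Lemma words_over_rcons G w a :
  words_over G (rcons w a) <-> words_over G w /\ G a.
Proof.
rewrite /words_over /= all_rcons; split.
  by case/andP=> /set_mem Ga Gw.
by case=> Gw Ga; apply/andP; split=> //; apply/mem_set.
Qed.

Lemma words_over_cons G w a :
  words_over G (a :: w) <-> G a /\ words_over G w.
Proof.
rewrite /words_over /=; split.
  by case/andP=> /set_mem Ga Gw.
by case=> Ga Gw; apply/andP; split=> //; apply/mem_set.
Qed.

Lemma receptive_nil G S : receptive G S -> S [::].
Proof. by case=> [[w Sw] Sp _]; exact: (Sp [::] w). Qed.

Lemma receptive_prefix G S : receptive G S -> prefix_closed S.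
Proof. by case. Qed.

Lemma prefix_closed_rcons S w a : prefix_closed S -> S (rcons w a) -> S w.
Proof. by move=> Sp; rewrite -cats1; apply: Sp. Qed.

Lemma receptive_comp G G1 G2 L1 L2 : G `<=` G1 -> G `<=` G2 ->
  receptive G1 L1 -> receptive G2 L2 -> receptive G (lang_comp L1 L2).
Proof.
move=> s1 s2 r1 r2; have n1 := receptive_nil r1; have n2 := receptive_nil r2.
case: r1 r2 => [_ p1 e1] [_ p2 e2]; split.
- by exists [::].
- by move=> u v [/p1 ? /p2 ?].
- have mono (G' : set Sigma) w : G `<=` G' -> words_over G w -> words_over G' w.
    move=> sG; elim: w => // a w IH /words_over_cons [Ga Gw].
    by apply/words_over_cons; split; [exact: sG|exact: IH].
  by move=> w w' [? ?] Gw'; split; [apply: e1 => //|apply: e2 => //]; exact: mono Gw'.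
Qed.

(** Letters are stripped from the end until a word of [S] remains, at the latest the empty one. *)
Lemma first_missing S w : S [::] -> ~ S w ->
  exists u a v, [/\ w = rcons u a ++ v, S u & ~ S (rcons u a)].
Proof.
move=> S0; elim/last_ind: w => [//|w a IH] nS.
have [Sw|/IH [u [b [v [-> Su nSu]]]]] := pselect (S w).
  by exists w, a, [::]; rewrite cats0.
by exists u, b, (rcons v a); rewrite rcons_cat.
Qed.

Lemma miss_extI S G u a v :
  S u -> G a -> ~ S (rcons u a) -> miss_ext S G (rcons u a ++ v).
Proof.
move=> Su Ga nS; exists (rcons u a); last by exists v.
split=> //; exists u => //; exists [:: a]; last by rewrite cats1.
by exists a.
Qed.

Lemma miss_extE S G w : miss_ext S G w ->
  exists u a v, [/\ w = rcons u a ++ v, S u, G a & ~ S (rcons u a)].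
Proof.
by move=> [_ [[u Su [_ [a Ga <-]]] <-]]; rewrite cats1 => nS [v _ <-]; exists u, a, v.
Qed.

(** With its converse [extensionE], this reduces [miss_ext] to a condition on the letter of exit
    from [S]. *)
Lemma extensionI S G w : S [::] ->
  (forall u a v, w = rcons u a ++ v -> S u -> ~ S (rcons u a) -> G a) ->
  extension S G w.
Proof.
move=> S0 H; have [|/(first_missing S0)[u [a [v [e Su nS]]]]] := pselect (S w).
  by left.
by right; rewrite e; apply: miss_extI => //; exact: H e Su nS.
Qed.

Lemma prefix_closed_extension S G :
  prefix_closed S -> prefix_closed (extension S G).
Proof.
move=> Sp u v; elim/last_ind: v => [|v a IH]; first by rewrite cats0.
rewrite -rcons_cat => Ew; apply: IH; case: Ew => [/prefix_closed_rcons Sw|].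
  by left; exact: Sw.
case/miss_extE=> x [b [y [+ Sx Gb nS]]]; case/lastP: y => [|y c].
  by rewrite cats0 => /rcons_inj [-> _]; left.
by rewrite -rcons_cat => /rcons_inj [-> _]; right; exact: miss_extI.
Qed.

Lemma extension_rcons S G w a : extension S G w -> G a ->
  extension S G (rcons w a).
Proof.
move=> [Sw|/miss_extE[x [b [y [-> Sx Gb nS]]]]] Ga.
  have [|nS] := pselect (S (rcons w a)); first by left.
  by right; rewrite -[rcons w a]cats0; exact: miss_extI.
by right; rewrite rcons_cat; exact: miss_extI.
Qed.

Lemma receptive_extension S G : receptive set0 S -> receptive G (extension S G).
Proof.
move=> Sr; split.
- by exists [::]; left; exact: receptive_nil Sr.
- exact/prefix_closed_extension/(receptive_prefix Sr).
- move=> w w' Ew; elim/last_ind: w' => [|w' a IH]; first by rewrite cats0.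
  by case/words_over_rcons=> /IH Ew' Ga; rewrite -rcons_cat; exact: extension_rcons.
Qed.

Lemma extension_rconsE S G u a : prefix_closed S ->
  extension S G (rcons u a) -> S u -> ~ S (rcons u a) -> G a.
Proof.
move=> Sp [//|/miss_extE[x [b [y [+ Sx Gb nS]]]]] => + Su _.
(* With a nonempty tail [y], the missing word [rcons x b] would be a prefix of [u], hence in [S]. *)
case/lastP: y => [|y c]; first by rewrite cats0 => /rcons_inj [_ ->].
by rewrite -rcons_cat => /rcons_inj [e _]; case: nS; apply: (Sp _ y); rewrite -e.
Qed.

Lemma extensionE S G u a v : prefix_closed S ->
  extension S G (rcons u a ++ v) -> S u -> ~ S (rcons u a) -> G a.
Proof. by move=> Sp /(prefix_closed_extension Sp); exact: extension_rconsE. Qed.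

Lemma extensionI_disjoint S G G' : prefix_closed S -> S [::] ->
  G `&` G' = set0 -> extension S G `&` extension S G' = S.
Proof.
move=> Sp S0 dis; apply/seteqP; split=> [w [E1 E2]|w Sw]; last by split; left.
apply: contrapT => /(first_missing S0)[u [a [v [e Su nS]]]].
have: (G `&` G') a.
  by rewrite e in E1 E2; split; [exact: extensionE E1 _ _|exact: extensionE E2 _ _].
by rewrite dis.
Qed.

(** * Closure under outputs, and clashes *)

Definition output_closed L O S : Prop :=
  forall u a, S u -> O a -> L (rcons u a) -> S (rcons u a).

(** If the exit letter from [S] is in [O1], closure makes [L1] refuse it too, so membership in
    [extension L1 I1] still puts it in [I1]; likewise for [L2]. *)
Lemma output_closed_impl S L1 L2 I1 I2 O1 O2 :
  S [::] -> prefix_closed L1 -> prefix_closed L2 -> S `<=` L1 -> S `<=` L2 ->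
  I1 `|` O1 = setT -> I2 `|` O2 = setT ->
  output_closed L1 O1 S -> output_closed L2 O2 S ->
  extension L1 I1 `&` extension L2 I2 `<=` extension S (I1 `&` I2).
Proof.
move=> S0 p1 p2 s1 s2 IO1 IO2 c1 c2 w [E1 E2]; apply: extensionI => // u a v e Su nS.
rewrite e in E1 E2; split.
  have [//|Oa] : (I1 `|` O1) a by rewrite IO1.
  by apply: (extensionE p1 E1 (s1 _ Su)) => /(c1 _ _ Su Oa).
have [//|Oa] : (I2 `|` O2) a by rewrite IO2.
by apply: (extensionE p2 E2 (s2 _ Su)) => /(c2 _ _ Su Oa).
Qed.

Lemma output_closed_env S L1 L2 I1 O1 O2 :
  S [::] -> prefix_closed S -> prefix_closed L1 -> prefix_closed L2 ->
  L2 [::] -> S `<=` L1 -> I1 `&` O1 = set0 ->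
  S `<=` L2 -> output_closed L1 O1 S -> output_closed L2 O2 S ->
  extension S (O1 `|` O2) `&` extension L1 I1 `<=` extension L2 O2.
Proof.
move=> S0 pS p1 p2 L20 s1 IO1 s2 c1 c2 w [ES E1].
(* No [O1] letter takes [w] out of [S]: [w] can leave [L1] only at an [I1] letter, and inside [L1]
   closure applies. *)
have stay1 u a v : w = rcons u a ++ v -> S u -> O1 a -> S (rcons u a).
  move=> e Su Oa; apply: c1 => //; apply: contrapT => nL.
  rewrite e in E1; suff: (I1 `&` O1) a by rewrite IO1.
  by split=> //; exact: extensionE E1 (s1 _ Su) nL.
apply: extensionI => // u a v e L2u nL2.
(* An earlier exit from [S] would be at an [O1] letter, against [stay1], or at an [O2] letter inside
   [L2], against closure. *)
have Su : S u.
  apply: contrapT => /(first_missing S0)[x [b [y [eu Sx nS]]]].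
  have e' : w = rcons x b ++ (y ++ a :: v) by rewrite e eu -cats1 -!catA.
  have [Ob|Ob] : (O1 `|` O2) b by rewrite e' in ES; exact: extensionE ES Sx nS.
    by apply: nS; exact: stay1 e' Sx Ob.
  by apply: nS; apply: c2 => //; apply: (p2 _ y); rewrite -eu.
have nS : ~ S (rcons u a) by move/s2.
have [Oa|//] : (O1 `|` O2) a by rewrite e in ES; exact: extensionE ES Su nS.
by case: nS; exact: stay1 e Su Oa.
Qed.

Definition clash L1 L2 O1 O2 w : Prop :=
  exists v b, [/\ words_over (O1 `|` O2) v, L1 (w ++ v), L2 (w ++ v) &
    (O1 b /\ L1 (rcons (w ++ v) b) /\ ~ L2 (rcons (w ++ v) b)) \/
    (O2 b /\ L2 (rcons (w ++ v) b) /\ ~ L1 (rcons (w ++ v) b))].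

(** Receptiveness brings the clashing word into [E]. The inclusion for the refusing component then
    makes the refused letter an output of that component as well, against disjointness. *)
Lemma clash_not_env E L1 L2 I1 I2 O1 O2 w :
  receptive (O1 `|` O2) E -> prefix_closed L1 -> prefix_closed L2 ->
  O1 `&` O2 = set0 ->
  E `&` extension L1 I1 `<=` extension L2 O2 ->
  E `&` extension L2 I2 `<=` extension L1 O1 ->
  clash L1 L2 O1 O2 w -> ~ E w.
Proof.
move=> [_ _ rE] p1 p2 dis E12 E21 [v [b [Ov L1v L2v c]]] Ew.
have Ewvb : (O1 `|` O2) b -> E (rcons (w ++ v) b).
  by move=> Ob; rewrite rcons_cat; apply: rE => //; apply/words_over_rcons.
suff: (O1 `&` O2) b by rewrite dis.
case: c => [[Ob [Lb nLb]]|[Ob [Lb nLb]]]; split=> //.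
  apply: (extension_rconsE p2 _ L2v nLb).
  by apply: E12; split; [apply: Ewvb; left|left].
apply: (extension_rconsE p1 _ L1v nLb).
by apply: E21; split; [apply: Ewvb; right|left].
Qed.

End PrefixClosedLanguages.

(** * Interface hypercontracts through their greatest elements *)

Section InterfaceContracts.
Variables (Sigma : Type) (s : io_sig Sigma).
Implicit Types S : language Sigma.

Lemma max_env_env S :
  receptive set0 S -> environments (interface_hc s S) (max_env s S).
Proof. by move=> rS; split=> //; exact: receptive_extension. Qed.

Lemma max_impl_impl S :
  receptive set0 S -> implementations (interface_hc s S) (max_impl s S).
Proof. by move=> rS; split=> //; exact: receptive_extension. Qed.

Lemma max_env_impl S :
  receptive set0 S -> max_env s S `&` max_impl s S = S.
Proof.
move=> rS; apply: extensionI_disjoint; first exact: receptive_prefix rS.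
  exact: receptive_nil rS.
by rewrite setIC inpIout.
Qed.

Lemma interface_hc_refinesP S S' :
  receptive set0 S -> receptive set0 S' ->
  refines (interface_hc s S) (interface_hc s S') <->
  max_env s S' `<=` max_env s S /\ max_impl s S `<=` max_impl s S'.
Proof.
move=> rS rS'; split=> [[eE iI]|[sE sI]].
  by split; [case: (eE _ (max_env_env rS'))|case: (iI _ (max_impl_impl rS))].
split=> [E [rE sE']|M [rM sM]]; split=> //.
  exact: subset_trans sE' sE.
exact: subset_trans sM sI.
Qed.

(** By [max_env_impl] the greatest environment and implementation determine [S] as their
    intersection. *)
Lemma refines_anti C C' : is_interface_hc s C -> is_interface_hc s C' ->
  refines C C' -> refines C' C -> C = C'.
Proof.
move=> [S rS ->] [S' rS' ->] /(interface_hc_refinesP rS rS') [e1 i1].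
move=> /(interface_hc_refinesP rS' rS) [e2 i2].
congr interface_hc; rewrite -(max_env_impl rS) -(max_env_impl rS').
by congr (_ `&` _); apply/seteqP.
Qed.

End InterfaceContracts.

(** * Compatible signatures *)

Lemma compatible_outI (Sigma : Type) (s1 s2 : io_sig Sigma) :
  compatible s1 s2 -> out s1 `&` out s2 = set0.
Proof.
move=> c; apply/seteqP; split=> // a [o1 o2].
have [i|i] : (inp s1 `|` inp s2) a by rewrite c.
  by rewrite -(inpIout s1).
by rewrite -(inpIout s2).
Qed.

Lemma compatible_out_inp (Sigma : Type) (s1 s2 : io_sig Sigma) :
  compatible s1 s2 -> out s2 `<=` inp s1.
Proof.
move=> c a o2; have [//|i] : (inp s1 `|` inp s2) a by rewrite c.
by suff: (inp s2 `&` out s2) a by rewrite inpIout.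
Qed.

Lemma compatible_sym (Sigma : Type) (s1 s2 : io_sig Sigma) :
  compatible s1 s2 -> compatible s2 s1.
Proof. by rewrite /compatible setUC. Qed.

(** * Parallel composition at the level of languages, without automata *)

Section ParallelComposition.
Variables (Sigma : Type) (s1 s2 : io_sig Sigma).
Hypothesis hcompat : compatible s1 s2.
Variables L1 L2 R : language Sigma.
Hypotheses (r1 : receptive set0 L1) (r2 : receptive set0 L2).
Hypotheses (rR : receptive set0 R) (sR1 : R `<=` L1) (sR2 : R `<=` L2).
Hypothesis c1 : output_closed L1 (out s1) R.
Hypothesis c2 : output_closed L2 (out s2) R.
Hypothesis leaveR : forall u a, R u -> L1 (rcons u a) -> L2 (rcons u a) ->
  ~ R (rcons u a) -> clash L1 L2 (out s1) (out s2) (rcons u a).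

Let C1 := interface_hc s1 L1.
Let C2 := interface_hc s2 L2.
Let p1 := receptive_prefix r1.
Let p2 := receptive_prefix r2.

Lemma par_admissible_output_closed :
  par_admissible s1 s2 C1 C2 (interface_hc (par_sig s1 s2) R).
Proof.
have R0 := receptive_nil rR; have pR := receptive_prefix rR.
split; first by exists R.
- move=> _ [M1 [rM1 sM1] [M2 [rM2 sM2] <-]]; split.
    by apply: receptive_comp rM1 rM2 => ? [].
  apply: subset_trans (setISS sM1 sM2) _.
  apply: output_closed_impl R0 p1 p2 sR1 sR2 _ _ c1 c2; exact: inpUout.
- move=> _ [E [rE sE] [M [rM sM] <-]]; split.
    by apply: receptive_comp rE rM; [right|exact: compatible_out_inp].
  apply: subset_trans (setISS sE sM) _.
  apply: output_closed_env R0 pR p1 p2 _ sR1 _ sR2 c1 c2; last exact: inpIout.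
  exact: receptive_nil r2.
- move=> _ [E [rE sE] [M [rM sM] <-]]; split.
    apply: receptive_comp rE rM; first by left.
    exact/compatible_out_inp/compatible_sym.
  (* The previous case with the components exchanged; the net effect of the rewrites is to swap the
     two output sets. *)
  apply: subset_trans (setISS sE sM) _; rewrite /max_env /= setUC.
  rewrite (setUC (out s1)) (setUC _ R).
  apply: output_closed_env R0 pR p2 p1 _ sR2 _ sR1 c2 c1; last exact: inpIout.
  exact: receptive_nil r1.
Qed.

Lemma par_admissible_refines C :
  par_admissible s1 s2 C1 C2 C -> refines (interface_hc (par_sig s1 s2) R) C.
Proof.
case=> -[R' rR' ->] aI aE2 aE1.
have R0 := receptive_nil rR; have pR := receptive_prefix rR.
(* Applied to greatest elements, the admissibility conditions become the inclusions [sI], [sE2] and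
   [sE1]. *)
have mE := max_env_env (par_sig s1 s2) rR'.
have mM1 := max_impl_impl s1 r1; have mM2 := max_impl_impl s2 r2.
have [_ sI] : implementations (interface_hc (par_sig s1 s2) R')
    (max_impl s1 L1 `&` max_impl s2 L2).
  by apply: aI; exists (max_impl s1 L1) => //; exists (max_impl s2 L2).
have [_ sE2] : environments C2 (max_env (par_sig s1 s2) R' `&` max_impl s1 L1).
  by apply: aE2; exists (max_env (par_sig s1 s2) R') => //; exists (max_impl s1 L1).
have [_ sE1] : environments C1 (max_env (par_sig s1 s2) R' `&` max_impl s2 L2).
  by apply: aE1; exists (max_env (par_sig s1 s2) R') => //; exists (max_impl s2 L2).
(* An exit from [R] at a common input stays in both [max_impl], so [sE1] and [sE2] put the word in
   [L1] and [L2]; [leaveR] then gives a clash inside an environment. *)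
have envR : max_env (par_sig s1 s2) R' `<=` max_env (par_sig s1 s2) R.
  move=> w Ew; apply: extensionI => // u a v e Ru nR.
  have [[i1 i2]|//] :
      (inp (par_sig s1 s2) `|` out (par_sig s1 s2)) a by rewrite inpUout.
  have {}Ew : max_env (par_sig s1 s2) R' (rcons u a).
    by move: Ew; rewrite e; apply/prefix_closed_extension/(receptive_prefix rR').
  have M1 : max_impl s1 L1 (rcons u a).
    by apply: extension_rcons => //; left; exact: sR1.
  have M2 : max_impl s2 L2 (rcons u a).
    by apply: extension_rcons => //; left; exact: sR2.
  have L1a : L1 (rcons u a).
    by rewrite -(max_env_impl s1 r1); split=> //; apply: sE1.
  have L2a : L2 (rcons u a).
    by rewrite -(max_env_impl s2 r2); split=> //; apply: sE2.
  have := leaveR Ru L1a L2a nR.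
  by case/(clash_not_env mE.1 p1 p2 (compatible_outI hcompat) sE2 sE1).
apply/interface_hc_refinesP => //; split=> // w Mw.
apply: extensionI => [|u a v e R'u nR']; first exact: receptive_nil rR'.
have [//|oa] :
    (inp (par_sig s1 s2) `|` out (par_sig s1 s2)) a by rewrite inpUout.
have {}Mw : max_impl (par_sig s1 s2) R (rcons u a).
  by move: Mw; rewrite e; apply/prefix_closed_extension.
(* By [envR], [u] lies in both greatest elements for [R]. The output [a] cannot leave [R], so
   [rcons u a] is in [L1] and [L2], and [sI] forces [a] to be an input. *)
have Ru : R u.
  rewrite -(max_env_impl (par_sig s1 s2) rR); split; first by apply: envR; left.
  by apply: prefix_closed_rcons Mw; exact: prefix_closed_extension.
have Ra : R (rcons u a).
  apply: contrapT => /(extension_rconsE pR Mw Ru) ia.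
  by suff: (inp (par_sig s1 s2) `&` out (par_sig s1 s2)) a by rewrite inpIout.
apply: (extension_rconsE (receptive_prefix rR') _ R'u nR').
by apply: sI; split; left; [exact: sR1|exact: sR2].
Qed.

End ParallelComposition.

(** * Runs and languages of deterministic automata *)

Section Runs.
Variables (Sigma : Type) (s : io_sig Sigma) (A : automaton s).
Implicit Types (p q : state A) (w : seq Sigma).

Lemma run_rcons p w a q :
  run p (rcons w a) q <-> exists2 r, run p w r & step r a q.
Proof.
elim: w p => [|b w IH] p /=.
  by split=> [[r sr <-]|[_ <- sq]]; [exists p|exists q].
split=> [[r sr /IH[t rt st]]|[t [r sr rt] st]].
  by exists t => //; exists r.
by exists r => //; apply/IH; exists t.
Qed.

Lemma run_det p w q q' : run p w q -> run p w q' -> q = q'.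
Proof.
elim: w p => [|a w IH] p /=; first by move=> <-.
by move=> [r sr rq] [r' sr' rq']; apply: (IH r) => //; rewrite (step_det sr sr').
Qed.

(** By determinism [q] is the only state reached by [w]. *)
Lemma lang_rcons w a q :
  run (init A) w q -> lang A (rcons w a) <-> enabled q a.
Proof.
move=> rq; split=> [[q' /run_rcons [r rr sr]]|[q' sq]]; exists q'.
  by rewrite (run_det rq rr).
by apply/run_rcons; exists q.
Qed.

Lemma receptive_lang : receptive set0 (lang A).
Proof.
have pL : prefix_closed (lang A).
  move=> u v; elim/last_ind: v => [|v a IH]; first by rewrite cats0.
  by rewrite -rcons_cat => -[q /run_rcons[r rr _]]; apply: IH; exists r.
split=> //; first by exists [::], (init A).
by move=> w [|a w'] Lw; [rewrite cats0|case/words_over_cons].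
Qed.

End Runs.

(** * The language of the composite automaton *)

Section AutomatonComposition.
Variables (Sigma : Type) (s1 s2 : io_sig Sigma).
Variables (A1 : automaton s1) (A2 : automaton s2) (hdef : par_defined A1 A2).
Let P := par_automaton hdef.

Lemma run_par (p p' : state P) w : run p w p' ->
  run (val p).1 w (val p').1 /\ run (val p).2 w (val p').2.
Proof.
elim: w p => [|a w IH] p /=; first by move=> <-.
by move=> [r [st1 st2] /IH[rn1 rn2]]; split; [exists (val r).1|exists (val r).2].
Qed.

Lemma lang_par_subl : lang P `<=` lang A1.
Proof. by move=> w [q /run_par [rq _]]; exists (val q).1. Qed.

Lemma lang_par_subr : lang P `<=` lang A2.
Proof. by move=> w [q /run_par [_ rq]]; exists (val q).2. Qed.

Lemma valid_state (p : state P) : ~ invalid (val p).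
Proof. exact/asboolP/(valP p). Qed.

Lemma lang_par_rcons w a (p : state P) q : run (init P) w p ->
  prod_step (val p) a q -> ~ invalid q -> lang P (rcons w a).
Proof.
move=> rp st nq; exists (exist _ q (asboolT nq)).
by apply/run_rcons; exists p.
Qed.

(** Validity of the current pair is used twice: [A2] must accept the output, and the successor pair
    must be valid. *)
Lemma lang_par_output_closedl : output_closed (lang A1) (out s1) (lang P).
Proof.
move=> u a [p rp] oa; have [rp1 rp2] := run_par rp.
move/(lang_rcons _ rp1)=> en1.
have [q2 st2] : enabled (val p).2 a.
  by apply: contrapT => nen; apply: (@valid_state p); exact: invalid_out1 oa en1 nen.
have [q1 st1] := en1; apply: (lang_par_rcons rp (q := (q1, q2))) => // iq.
by apply: (@valid_state p); apply: invalid_step iq; [left; exact: oa|split].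
Qed.

Lemma lang_par_output_closedr : output_closed (lang A2) (out s2) (lang P).
Proof.
move=> u a [p rp] oa; have [rp1 rp2] := run_par rp.
move/(lang_rcons _ rp2)=> en2.
have [q1 st1] : enabled (val p).1 a.
  by apply: contrapT => nen; apply: (@valid_state p); exact: invalid_out2 oa en2 nen.
have [q2 st2] := en2; apply: (lang_par_rcons rp (q := (q1, q2))) => // iq.
by apply: (@valid_state p); apply: invalid_step iq; [right; exact: oa|split].
Qed.

(** Induction on the derivation of invalidity: the base clauses are clashes with empty continuation,
    and the step clause prepends its output letter. *)
Lemma invalid_clash (q : state A1 * state A2) w : invalid q ->
  run (init A1) w q.1 -> run (init A2) w q.2 ->
  clash (lang A1) (lang A2) (out s1) (out s2) w.
Proof.
move=> iq; elim: iq w => {q}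
  [q a oa en nen|q a oa en nen|q a q' oa [st1 st2] _ IH] w rn1 rn2.
- exists [::], a; rewrite cats0; split=> //; [by exists q.1|by exists q.2|right].
  by split=> //; split; [exact/(lang_rcons _ rn2)|move/(lang_rcons _ rn1)].
- exists [::], a; rewrite cats0; split=> //; [by exists q.1|by exists q.2|left].
  by split=> //; split; [exact/(lang_rcons _ rn1)|move/(lang_rcons _ rn2)].
- have [||v [b]] := IH (rcons w a).
  + by apply/run_rcons; exists q.1.
  + by apply/run_rcons; exists q.2.
  rewrite cat_rcons => -[Ov Lv1 Lv2 c]; exists (a :: v), b; split=> //.
  exact/words_over_cons.
Qed.

Lemma lang_par_leave u a : lang P u -> lang A1 (rcons u a) ->
  lang A2 (rcons u a) -> ~ lang P (rcons u a) ->
  clash (lang A1) (lang A2) (out s1) (out s2) (rcons u a).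
Proof.
move=> [p rp]; have [rp1 rp2] := run_par rp.
move=> /(lang_rcons _ rp1)[q1 st1] /(lang_rcons _ rp2)[q2 st2] nP.
apply: (@invalid_clash (q1, q2)).
(* Both components take the letter, so only invalidity of the target can block it. *)
- by apply: contrapT => nq; apply: nP; exact: lang_par_rcons rp _ nq.
- by apply/run_rcons; exists (val p).1.
- by apply/run_rcons; exists (val p).2.
Qed.

End AutomatonComposition.

Theorem proposition9 (Sigma : Type) (s1 s2 : io_sig Sigma)
    (hcompat : compatible s1 s2) (A1 : automaton s1) (A2 : automaton s2)
    (hdef : par_defined A1 A2) (C : hypercontract Sigma) :
  is_hc_par s1 s2 (automaton_hc A1) (automaton_hc A2) C <->
  C = automaton_hc (par_automaton hdef).
Proof.
have r1 := receptive_lang A1; have r2 := receptive_lang A2.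
have rP := receptive_lang (par_automaton hdef).
have sub1 := @lang_par_subl _ _ _ _ _ hdef.
have sub2 := @lang_par_subr _ _ _ _ _ hdef.
have adm : par_admissible s1 s2 (automaton_hc A1) (automaton_hc A2)
    (automaton_hc (par_automaton hdef)).
  apply: par_admissible_output_closed => //.
    exact: lang_par_output_closedl.
  exact: lang_par_output_closedr.
have min C' : par_admissible s1 s2 (automaton_hc A1) (automaton_hc A2) C' ->
    refines (automaton_hc (par_automaton hdef)) C'.
  by apply: par_admissible_refines => //; exact: lang_par_leave.
(* Two least admissible contracts refine each other, hence coincide. *)
split=> [[admC minC]|->]; last by split.
have [hcC _ _ _] := admC; have [hcP _ _ _] := adm.
by apply: refines_anti hcC hcP (minC _ adm) (min _ admC).
Qed.
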